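(* Let $p\ge 3$ be an odd integer, let $\mathcal D_1$ and $\mathcal D_2$ be a pair of homothetic ellipses with common center, and let $\mathcal P$ denote the family of $p$-gons inscribed in $\mathcal D_1$ and circumscribed about $\mathcal D_2$. Then the sum of the areas of the power circles of a $p$-gon in $\mathcal P$ is invariant throughout the family; that is, for any two $p$-gons in $\mathcal P$, with power circles $\mathcal C_0,\dots,\mathcal C_{p-1}$ and $\mathcal C_0',\dots,\mathcal C_{p-1}'$ respectively, $$\sum_{k=0}^{p-1}\operatorname{Area}(\mathcal C_k)=\sum_{k=0}^{p-1}\operatorname{Area}(\mathcal C_k').$$
   Context: All objects lie in the Euclidean plane. A $p$-gon $A_0A_1\cdots A_{p-1}$ is a cyclically ordered sequence of $p$ distinct points (vertices), with sides $\overline{A_kA_{k+1}}$ (indices modulo $p$); it may be simple or self-crossing. It is inscribed in an ellipse if all its vertices lie on the ellipse, and circumscribed about an ellipse if every line $A_kA_{k+1}$ is tangent to the ellipse. Two ellipses with common center $O$ are homothetic if one is the image of the other under a homothety (scaling) centered at $O$; circles are allowed as ellipses. Power circles: write $p=2n+1$. For a $p$-gon $A_0A_1\cdots A_{2n}$, let $M_k$ be the midpoint of the segment $\overline{A_{n+k}A_{n+k+1}}$ (indices modulo $2n+1$). The power circle $\mathcal C_k$ corresponding to the vertex $A_k$ is the circle centered at $M_k$ passing through $A_k$. The area of a circle means the area of the disk it bounds. *)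

(* Defs.v *)
From HB Require Import structures.
From mathcomp Require Import all_boot all_order all_algebra.
From mathcomp Require Import all_classical all_reals all_analysis.

Set Implicit Arguments.
Unset Strict Implicit.
Unset Printing Implicit Defensive.

Import Order.TTheory GRing.Theory Num.Theory.

Local Open Scope classical_set_scope.
Local Open Scope ring_scope.

(* The Euclidean plane is R * R with the explicit Euclidean distance [dist];
   the library's norm on a product type is the sup norm and is not used. *)
Definition dot (R : realType) (u v : R * R) : R := u.1 * v.1 + u.2 * v.2.

Definition dist (R : realType) (P Q : R * R) : R :=
  Num.sqrt (dot (Q - P) (Q - P)).

Definition line (R : realType) (P Q : R * R) : set (R * R) :=
  [set X | exists t : R, X = P + t *: (Q - P)].

Definition midpoint (R : realType) (P Q : R * R) : R * R :=
  2^-1 *: (P + Q).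

(* Semi-axes a and b along the orthonormal frame u, (- u.2, u.1); the case
   a = b (circles) is allowed. *)
Definition ellipse (R : realType) (O : R * R) (E : set (R * R)) : Prop :=
  exists a b : R, exists u : R * R,
    [/\ 0 < a, 0 < b, dot u u = 1 &
      E = [set P | (dot (P - O) u / a) ^+ 2
                   + (dot (P - O) (- u.2, u.1) / b) ^+ 2 = 1]].

Definition homothety (R : realType) (O : R * R) (c : R) (P : R * R) : R * R :=
  O + c *: (P - O).

(* Symmetric in E and F, since the ratio c is nonzero. *)
Definition homothetic (R : realType) (O : R * R) (E F : set (R * R)) : Prop :=
  exists c : R, c != 0 /\ F = homothety O c @` E.

(* For an ellipse E, a line is tangent iff it meets E in exactly one point. *)
Definition tangent (R : realType) (L E : set (R * R)) : Prop :=
  exists! T : R * R, L T /\ E T.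

(* Vertices are indexed by 'Z_p, so that index arithmetic is modulo p; this is
   the intended index set only when 1 < p. *)
Definition is_polygon (R : realType) (p : nat) (A : 'Z_p -> R * R) : Prop :=
  injective A.

Definition inscribed (R : realType) (p : nat) (A : 'Z_p -> R * R)
    (E : set (R * R)) : Prop :=
  forall k : 'Z_p, E (A k).

Definition circumscribed (R : realType) (p : nat) (A : 'Z_p -> R * R)
    (E : set (R * R)) : Prop :=
  forall k : 'Z_p, tangent (line (A k) (A (k + 1))) E.

Definition poncelet_family (R : realType) (p : nat) (D1 D2 : set (R * R)) :
    set ('Z_p -> R * R) :=
  [set A | [/\ is_polygon A, inscribed A D1 & circumscribed A D2]].

Record circle (R : realType) := Circle { center : R * R ; radius : R }.

Definition disk (R : realType) (C : circle R) : set (R * R) :=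
  [set P | dist (center C) P <= radius C].

Definition area (R : realType) (C : circle R) : \bar R :=
  (@lebesgue_measure R \x @lebesgue_measure R)%E (disk C).

(* With p = 2n + 1, the number n is p./2. *)
Definition power_circle (R : realType) (p : nat) (A : 'Z_p -> R * R)
    (k : 'Z_p) : circle R :=
  let M := midpoint (A ((p./2)%:R + k)) (A ((p./2)%:R + k + 1)) in
  Circle M (dist M (A k)).

(* Main.v *)
Require Import Defs.
From mathcomp Require Import all_boot all_order all_algebra.
From mathcomp Require Import all_classical all_reals all_analysis.
From mathcomp Require Import measurable_realfun ring lra.

(** Dividing the coordinates of P - O along the axes of the outer ellipse by its
    semi-axes a and b turns it into the unit circle and the inner ellipse into a
    concentric circle of radius |c|, where c is the homothety ratio. The polygon
    becomes a sequence of unit vectors (x_k, y_k). By symmetry a chord touches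
    the concentric circle at its midpoint, so all the inner products of
    consecutive vectors have the same value kappa = 2 c^2 - 1
    ([tangent_chord]).

    A unit vector has at most two unit vectors at inner product kappa, mirror
    images of each other in its direction; consecutive vertices being distinct
    two steps apart, both occur ([unit_circle_neighbors]). Hence each coordinate
    satisfies f (k - 1) + f (k + 1) = 2 kappa f k, the recurrence of cos (k t)
    with cos t = kappa, and so f (k - n) + f (k + n) = 2 T_n(kappa) f k with T_n
    the n-th Chebyshev polynomial ([chebyshev_recurrence]). Since p = 2n + 1,
    vertex n + k + 1 is vertex k - n, so M_k - O = T_n(kappa) (A_k - O): the
    radius of the k-th power circle is |1 - T_n(kappa)| times the distance from
    A_k to O ([power_circle_radius]).

    This distance has square a^2 x_k^2 + b^2 y_k^2. The numbers
    x_k^2 - y_k^2 satisfy the same kind of recurrence with kappa replaced by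
    2 kappa^2 - 1, different from 1, so they sum to 0 ([sum_sqr_diff0]);
    therefore x_k^2 and y_k^2 both sum to p / 2. The sum of the squared radii is
    thus (1 - T_n(kappa))^2 p (a^2 + b^2) / 2, which depends on the two ellipses
    and p only ([sum_power_circle_radius]). Areas enter only through their
    proportionality to the squared radius ([area_scale]). *)

Set Implicit Arguments.
Unset Strict Implicit.
Unset Printing Implicit Defensive.

Import Order.TTheory GRing.Theory Num.Theory.
Import numFieldNormedType.Exports.

Local Open Scope classical_set_scope.
Local Open Scope ring_scope.

(** * Area of a disk and its radius *)

(** The square root of a negative number being 0, the formula also covers the
    vertical lines that miss the disk. *)
Lemma disk_xsection (R : realType) (c : R * R) (r x : R) : 0 <= r ->
  lebesgue_measure (xsection (disk (Circle c r)) x)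
  = (2 * Num.sqrt (r ^+ 2 - (x - c.1) ^+ 2))%:E.
Proof.
move=> r0; set q := r ^+ 2 - (x - c.1) ^+ 2.
have E : xsection (disk (Circle c r)) x
    = [set y | (y - c.2) ^+ 2 <= q].
  have sqrt_le z : (Num.sqrt z <= r) = (z <= r ^+ 2).
    by rewrite -{1}(ger0_norm r0) -sqrtr_sqr ler_sqrt ?sqr_ge0.
  apply/seteqP; split=> y; rewrite /xsection /disk /= inE /= /dist /dot /=
    sqrt_le /q; lra.
rewrite E; have [q0|q0] := ltP q 0.
  rewrite ltr0_sqrtr // mulr0 (_ : [set y | _] = set0) ?measure0 //.
  apply/seteqP; split=> y //=.
  by have := sqr_ge0 (y - c.2); lra.
have -> : [set y | (y - c.2) ^+ 2 <= q]
    = `[c.2 - Num.sqrt q, c.2 + Num.sqrt q]%classic.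
  apply/seteqP; split=> y /=;
    by rewrite in_itv /= -ler_distl -sqrtr_sqr ler_sqrt.
rewrite lebesgue_measure_itv /= lte_fin; case: ifPn => [_|].
  by rewrite -EFinD; congr EFin; ring.
by have := sqrtr_ge0 q; rewrite -leNgt => ??; congr EFin; lra.
Qed.

(** The section lengths of the two disks correspond under x |-> c.1 + r * x; the
    substitution contributes one factor r and the section length the other. *)
Lemma area_scale (R : realType) (c : R * R) (r : R) : 0 <= r ->
  area (Circle c r) = ((r ^+ 2)%:E * area (Circle (0 : R * R)%R 1%R))%E.
Proof.
move=> r0; rewrite /area /product_measure1 /=.
rewrite (eq_integral (fun x : measurableTypeR R =>
    (2 * Num.sqrt (r ^+ 2 - ((x : R) - c.1) ^+ 2))%:E)); last first.
  by move=> x _ /=; rewrite disk_xsection.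
rewrite [in RHS](eq_integral (fun x : measurableTypeR R =>
    (2 * Num.sqrt (1 - (x : R) ^+ 2))%:E)); last first.
  by move=> x _ /=; rewrite disk_xsection //= expr1n subr0.
(* The substitution below needs r > 0. *)
move: r0; rewrite le_eqVlt => /predU1P[<-|r0].
  rewrite expr0n mul0e; apply: integral0_eq => x _.
  by rewrite ler0_sqrtr ?mulr0 // sub0r oppr_le0 sqr_ge0.
have csq (g : R -> R) : continuous g ->
    continuous (fun x => 2 * Num.sqrt (g x)).
  move=> cg x; apply: cvgM; first exact: cvg_cst.
  exact: (@continuous_comp _ _ _ g (@Num.sqrt R) x (cg x)
    (@sqrt_continuous R _)).
have dF x : derivable (fun x : R => c.1 + r * x) x 1 by [].
have F1 : derive1 (fun x : R => c.1 + r * x) = cst r.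
  apply/funext => x; rewrite derive1E.
  rewrite deriveD // derive_cst add0r deriveM // derive_cst derive_id scaler0.
  by rewrite addr0 /GRing.scale /= mulr1.
rewrite (@increasing_ge0_integration_by_substitutionT R (fun x => c.1 + r * x)).
- rewrite F1 -ge0_integralZl //; last 2 first.
  + have c1 : continuous (fun x : R => 1 - x ^+ 2).
      by move=> x; apply: cvgB; [exact: cvg_cst | exact: exprn_continuous].
    apply/measurable_EFinP; exact: (continuous_measurable_fun (csq _ c1)).
  + by rewrite lee_fin sqr_ge0.
  + apply: eq_integral => x _; rewrite !fctE /= -EFinM; congr EFin.
    rewrite (_ : r ^+ 2 - _ = r ^+ 2 * (1 - (x:R) ^+ 2)); last by ring.
    by rewrite sqrtrM ?sqr_ge0 // sqrtr_sqr gtr0_norm //; ring.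
- by move=> x y xy; rewrite ltrD2l ltr_pM2l.
- by rewrite F1 => x; exact: cvg_cst.
- by rewrite F1; exact: is_cvg_cst.
- by rewrite F1; exact: is_cvg_cst.
- exact: dF.
- apply/cvgrNyPle => y; near=> x.
  have : x <= (y - c.1) / r by near: x; exact: nbhs_ninfty_le (num_real _).
  by rewrite ler_pdivlMr // mulrC; lra.
- apply/cvgryPge => y; near=> x.
  have : (y - c.1) / r <= x by near: x; exact: nbhs_pinfty_ge (num_real _).
  by rewrite ler_pdivrMr // mulrC; lra.
- apply: csq => x; apply: cvgB; first exact: cvg_cst.
  apply: (@continuous_comp _ _ _ (fun x => x - c.1) (fun x => x ^+ 2)).
    by apply: cvgB; [exact: cvg_id|exact: cvg_cst].
  exact: exprn_continuous.
- by move=> x; rewrite mulr_ge0 ?sqrtr_ge0.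
Unshelve. all: by end_near. Qed.

(** * Equally spaced points of the unit circle *)

(** A unit vector at inner product kappa from z = (x, y) is kappa z + s z', where
    z' is z turned by a right angle and s^2 = 1 - kappa^2; two distinct ones have
    opposite values of s, which cancel in their sum. *)
Lemma unit_circle_neighbors (R : idomainType) (kappa x y x1 y1 x2 y2 : R) :
  x ^+ 2 + y ^+ 2 = 1 -> x1 ^+ 2 + y1 ^+ 2 = 1 -> x2 ^+ 2 + y2 ^+ 2 = 1 ->
  x1 * x + y1 * y = kappa -> x * x2 + y * y2 = kappa ->
  (x1, y1) <> (x2, y2) ->
  x1 + x2 = 2 * kappa * x /\ y1 + y2 = 2 * kappa * y.
Proof.
move=> n0 n1 n2 h1 h2 ne.
pose s1 := x * y1 - y * x1; pose s2 := x * y2 - y * x2.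
have ex1 : x1 = kappa * x - s1 * y.
  by rewrite -[LHS]mul1r -n0 -h1 /s1; ring.
have ey1 : y1 = kappa * y + s1 * x.
  by rewrite -[LHS]mul1r -n0 -h1 /s1; ring.
have ex2 : x2 = kappa * x - s2 * y.
  by rewrite -[LHS]mul1r -n0 -h2 /s2; ring.
have ey2 : y2 = kappa * y + s2 * x.
  by rewrite -[LHS]mul1r -n0 -h2 /s2; ring.
have /eqP : s1 ^+ 2 = s2 ^+ 2.
  have -> : s1 ^+ 2 = (x ^+ 2 + y ^+ 2) * (x1 ^+ 2 + y1 ^+ 2)
                      - (x1 * x + y1 * y) ^+ 2 by rewrite /s1; ring.
  have -> : s2 ^+ 2 = (x ^+ 2 + y ^+ 2) * (x2 ^+ 2 + y2 ^+ 2)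
                      - (x * x2 + y * y2) ^+ 2 by rewrite /s2; ring.
  by rewrite n0 n1 n2 h1 h2.
rewrite eqf_sqr => /orP[/eqP s12|/eqP s12].
  by case: ne; rewrite ex1 ey1 ex2 ey2 s12.
by rewrite ex1 ey1 ex2 ey2 s12; split; ring.
Qed.

Fixpoint chebyshev (R : pzRingType) (x : R) (n : nat) : R :=
  match n with
  | 0 => 1
  | 1 => x
  | (m.+1 as k).+1 => 2 * x * chebyshev x k - chebyshev x m
  end.

(** For f k = cos (k t) and x = cos t this is the addition formula
    cos (k - n) t + cos (k + n) t = 2 cos (n t) cos (k t). *)
Lemma chebyshev_recurrence (R : idomainType) (V : zmodType) (e : V) (x : R)
    (f : V -> R) (hf : forall k, f (k - e) + f (k + e) = 2 * x * f k) n k :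
  f (k - e *+ n) + f (k + e *+ n) = 2 * chebyshev x n * f k.
Proof.
(* The recurrence has order two, hence the induction carries two consecutive
   values of n. *)
suff: f (k - e *+ n) + f (k + e *+ n) = 2 * chebyshev x n * f k
   /\ f (k - e *+ n.+1) + f (k + e *+ n.+1) = 2 * chebyshev x n.+1 * f k
  by case.
elim: n => [|n [IH0 IH1]].
  by rewrite mulr0n subr0 addr0 mulr1n hf /=; split => //; ring.
split=> //.
have E1 := hf (k - e *+ n.+1); have E2 := hf (k + e *+ n.+1).
have d1 : k - e *+ n.+1 - e = k - e *+ n.+2.
  by rewrite [in RHS]mulrS opprD [- e - _]addrC addrA.
have d2 : k - e *+ n.+1 + e = k - e *+ n.
  by rewrite mulrS opprD [- e - _]addrC addrA addrNK.
have d3 : k + e *+ n.+1 - e = k + e *+ n by rewrite mulrSr addrA addrK.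
have d4 : k + e *+ n.+1 + e = k + e *+ n.+2 by rewrite [in RHS]mulrSr addrA.
rewrite {}d1 {}d2 in E1; rewrite {}d3 {}d4 in E2.
transitivity ((f (k - e *+ n.+2) + f (k - e *+ n))
  + (f (k + e *+ n) + f (k + e *+ n.+2))
  - (f (k - e *+ n) + f (k + e *+ n))); first by ring.
rewrite E1 E2 IH0 -mulrDr IH1.
rewrite -[chebyshev x n.+2]/(2 * x * chebyshev x n.+1 - chebyshev x n); ring.
Qed.

(** In complex notation x_k^2 - y_k^2 is the real part of z_k^2, and
    z_(k+e) = z_k w gives z_(k-e)^2 + z_(k+e)^2 = z_k^2 (w^2 + w^-2), where
    w^2 + w^-2 = 2 (2 kappa^2 - 1). Summing over k and shifting indices gives
    D = (2 kappa^2 - 1) D for the sum D. *)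
Lemma sum_sqr_diff0 (R : numDomainType) (V : finZmodType) (e : V) (kappa : R)
    (x y : V -> R) :
  (forall k, x k ^+ 2 + y k ^+ 2 = 1) ->
  (forall k, x k * x (k + e) + y k * y (k + e) = kappa) ->
  (forall k, x (k - e) + x (k + e) = 2 * kappa * x k) ->
  (forall k, y (k - e) + y (k + e) = 2 * kappa * y k) ->
  kappa ^+ 2 != 1 ->
  \sum_k (x k ^+ 2 - y k ^+ 2) = 0.
Proof.
move=> n1 hk hx hy k1; set D := \sum_k _.
pose d k := x k ^+ 2 - y k ^+ 2.
have hd k : d (k - e) + d (k + e) = 2 * (2 * kappa ^+ 2 - 1) * d k.
  (* The real part of z_(k-e) z_(k+e) = z_k^2, with z_(k-e) eliminated. *)
  have key : 2 * kappa * (x k * x (k + e) - y k * y (k + e))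
      - (x (k + e) ^+ 2 - y (k + e) ^+ 2) = d k.
    transitivity ((x (k + e) ^+ 2 + y (k + e) ^+ 2) * d k
      + (x k ^+ 2 + y k ^+ 2 - 1) * (x (k + e) ^+ 2 - y (k + e) ^+ 2)).
      by rewrite -(hk k) /d; ring.
    by rewrite !n1; ring.
  transitivity (4 * kappa ^+ 2 * d k
    - 2 * (2 * kappa * (x k * x (k + e) - y k * y (k + e))
      - (x (k + e) ^+ 2 - y (k + e) ^+ 2))).
    rewrite /d.
    have -> : x (k - e) = 2 * kappa * x k - x (k + e) by rewrite -hx addrK.
    have -> : y (k - e) = 2 * kappa * y k - y (k + e) by rewrite -hy addrK.
    ring.
  by rewrite key; ring.
have shift h : \sum_k d (k + h) = D.
  by rewrite [RHS](reindex (fun k => k + h)) //; exists (fun k => k - h) => k _;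
    rewrite ?addrK ?addrNK.
have : \sum_k (d (k - e) + d (k + e)) = 2 * (2 * kappa ^+ 2 - 1) * D.
  by rewrite mulr_sumr; apply: eq_bigr => k _; exact: hd.
rewrite big_split /= !shift => h.
have /eqP : (kappa ^+ 2 - 1) * D *+ 4 = 0.
  by transitivity (2 * (2 * kappa ^+ 2 - 1) * D - (D + D));
    [ring|rewrite h subrr].
by rewrite mulrn_eq0 mulf_eq0 subr_eq0 (negPf k1) /= => /eqP.
Qed.

(** * Coordinates along the axes of the ellipse *)

Definition perp (R : realType) (u : R * R) : R * R := (- u.2, u.1).

(** For w a unit axis and s the semi-axis along it, this coordinate makes the
    ellipse the unit circle. *)
Definition coord (R : realType) (O w : R * R) (s : R) (P : R * R) : R :=
  dot (P - O) w / s.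

Lemma dot_frame (R : realType) (u v : R * R) : dot u u = 1 ->
  dot v v = dot v u ^+ 2 + dot v (perp u) ^+ 2.
Proof. by move=> u1; rewrite -[LHS]mulr1 -u1 /perp /dot /=; ring. Qed.

(** Scaling in R * R reduces componentwise to the scaling of R as a module over
    itself, which [ring] and [field] see as a product only after this rewriting. *)
Lemma scaler_realE (R : realType) (c t : R) : c *: t = c * t.
Proof. by []. Qed.

Lemma coord_segment (R : realType) (O w : R * R) (s t : R) (P Q : R * R) :
  coord O w s (P + t *: (Q - P)) = (1 - t) * coord O w s P + t * coord O w s Q.
Proof. by rewrite /coord /dot /= !scaler_realE; ring. Qed.

Lemma coord_homothety (R : realType) (O w : R * R) (s c : R) (P : R * R) :
  coord O w s (homothety O c P) = c * coord O w s P.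
Proof. by rewrite /coord /homothety /dot /= !scaler_realE; ring. Qed.

Lemma dot_sub_midpoint (R : realType) (O w : R * R) (s : R) (S P Q : R * R) :
  s != 0 ->
  dot (S - midpoint P Q) w
  = s * (coord O w s S - (coord O w s P + coord O w s Q) / 2).
Proof.
by move=> s0; rewrite /coord /midpoint /dot /= !scaler_realE; field.
Qed.

Lemma coord_inj (R : realType) (O u : R * R) (a b : R) (P Q : R * R) :
  dot u u = 1 -> a != 0 -> b != 0 ->
  coord O u a P = coord O u a Q ->
  coord O (perp u) b P = coord O (perp u) b Q -> P = Q.
Proof.
move=> u1 a0 b0 hx hy; apply/eqP; rewrite -subr_eq0.
(* Writing Q as a midpoint lets [dot_sub_midpoint] express P - Q. *)
have Q2 : Q = midpoint Q Q.
  by apply: injective_projections; rewrite /= scaler_realE; field.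
have : dot (P - Q) (P - Q) == 0.
  rewrite (dot_frame _ u1) Q2 (dot_sub_midpoint O _ _ _ _ a0).
  by rewrite (dot_sub_midpoint O _ _ _ _ b0) hx hy; apply/eqP; field.
rewrite /dot -!expr2 paddr_eq0 ?sqr_ge0 // !sqrf_eq0 => /andP[/eqP e1 /eqP e2].
by apply/eqP; case: (P - Q) e1 e2 => /= ? ? -> ->.
Qed.

Lemma homothetic_ellipseP (R : realType) (O u : R * R) (a b c : R)
    (D : set (R * R)) (S : R * R) : c != 0 ->
  D = [set P | coord O u a P ^+ 2 + coord O (perp u) b P ^+ 2 = 1] ->
  (homothety O c @` D) S <->
  coord O u a S ^+ 2 + coord O (perp u) b S ^+ 2 = c ^+ 2.
Proof.
move=> c0 ->; split=> [[P /= h <-]|h].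
  by rewrite !coord_homothety -[RHS]mulr1 -h; ring.
exists (homothety O c^-1 S) => /=.
  have -> : 1 = c^-1 ^+ 2 * c ^+ 2 :> R by rewrite -exprMn mulVf // expr1n.
  by rewrite !coord_homothety -h; ring.
by rewrite /homothety [in c *: _]addrC addKr
  scalerA mulfV // scale1r addrC subrK.
Qed.

(** * Chords tangent to a homothetic ellipse *)

(** Along the chord the quadratic form defining the ellipses is invariant under
    t |-> 1 - t, so a unique common point has t = 1/2; there the form has the
    value (1 + x_P x_Q + y_P y_Q) / 2, which must be c^2. *)
Lemma tangent_chord (R : realType) (O u : R * R) (a b c : R) (D : set (R * R))
    (P Q : R * R) : c != 0 ->
  D = [set P | coord O u a P ^+ 2 + coord O (perp u) b P ^+ 2 = 1] ->
  P <> Q -> D P -> D Q -> tangent (line P Q) (homothety O c @` D) ->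
  coord O u a P * coord O u a Q + coord O (perp u) b P * coord O (perp u) b Q
  = 2 * c ^+ 2 - 1.
Proof.
move=> c0 ED PQ; rewrite {1 2}ED /=.
set x := coord O u a; set y := coord O (perp u) b => nP nQ.
have E2 S : (homothety O c @` D) S <-> x S ^+ 2 + y S ^+ 2 = c ^+ 2.
  exact: homothetic_ellipseP.
move=> [_ [[[t ->] /E2 hT] uniqT]].
have hx s : x (P + s *: (Q - P)) = (1 - s) * x P + s * x Q.
  exact: coord_segment.
have hy s : y (P + s *: (Q - P)) = (1 - s) * y P + s * y Q.
  exact: coord_segment.
have along s : x (P + s *: (Q - P)) ^+ 2 + y (P + s *: (Q - P)) ^+ 2
    = 1 - 2 * s * (1 - s) * (1 - (x P * x Q + y P * y Q)).
  rewrite hx hy.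
  transitivity ((1 - s) ^+ 2 * (x P ^+ 2 + y P ^+ 2)
    + s ^+ 2 * (x Q ^+ 2 + y Q ^+ 2)
    + 2 * s * (1 - s) * (x P * x Q + y P * y Q)); first by ring.
  by rewrite nP nQ; ring.
have /addrI /eqP : P + t *: (Q - P) = P + (1 - t) *: (Q - P).
  apply: uniqT; split; first by exists (1 - t).
  by apply/E2; rewrite -hT !along; ring.
rewrite -subr_eq0 -scalerBl scaler_eq0.
move=> /orP[/eqP t2|/eqP/subr0_eq QP]; last by case: PQ.
have {}t2 : t = 2^-1 by lra.
by move: hT; rewrite along t2; lra.
Qed.

(** * Power circles of a Poncelet polygon *)

(** Modulo p = 2n + 1 the side opposite to A_k joins A_(k+n) and A_(k-n), so the
    recurrence puts its midpoint on the line through O and A_k, at the ratio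
    T_n(kappa). *)
Lemma power_circle_radius (R : realType) (O u : R * R) (a b : R) (p : nat)
    (A : 'Z_p -> R * R) (kappa : R) (k : 'Z_p)
    (x := coord O u a \o A) (y := coord O (perp u) b \o A) :
  dot u u = 1 -> a != 0 -> b != 0 -> (1 < p)%N -> odd p ->
  (forall k, x (k - 1) + x (k + 1) = 2 * kappa * x k) ->
  (forall k, y (k - 1) + y (k + 1) = 2 * kappa * y k) ->
  Defs.radius (power_circle A k) ^+ 2
  = (1 - chebyshev kappa p./2) ^+ 2 * (a ^+ 2 * x k ^+ 2 + b ^+ 2 * y k ^+ 2).
Proof.
move=> u1 a0 b0 p1 podd hx hy; rewrite /= /dist.
rewrite sqr_sqrtr; last by rewrite /dot -!expr2 addr_ge0 // sqr_ge0.
have -> : (p./2)%:R + k + 1 = k - (p./2)%:R.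
  have h : (1 + (p./2 + p./2))%N%:R = 0 :> 'Z_p.
    by rewrite addnn -[1%N]/(true : nat) -podd odd_double_half pchar_Zp.
  rewrite !natrD in h; apply/eqP; rewrite -subr_eq0 -h; apply/eqP; ring.
rewrite [(p./2)%:R + k]addrC (dot_frame _ u1).
set Q := A (k - _); set P := A (k + _).
have eX : coord O u a P + coord O u a Q = 2 * chebyshev kappa p./2 * x k.
  by rewrite addrC; exact: chebyshev_recurrence hx p./2 k.
have eY : coord O (perp u) b P + coord O (perp u) b Q
    = 2 * chebyshev kappa p./2 * y k.
  by rewrite addrC; exact: chebyshev_recurrence hy p./2 k.
rewrite (dot_sub_midpoint O _ _ _ _ a0) (dot_sub_midpoint O _ _ _ _ b0) eX eY.
by rewrite /x /y /=; field.
Qed.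

Lemma sum_power_circle_radius (R : realType) (O u : R * R) (a b c : R) (p : nat)
    (D : set (R * R)) (A : 'Z_p -> R * R) :
  dot u u = 1 -> a != 0 -> b != 0 -> c != 0 -> (3 <= p)%N -> odd p ->
  D = [set P | coord O u a P ^+ 2 + coord O (perp u) b P ^+ 2 = 1] ->
  poncelet_family D (homothety O c @` D) A ->
  \sum_k Defs.radius (power_circle A k) ^+ 2
  = (1 - chebyshev (2 * c ^+ 2 - 1) p./2) ^+ 2
    * (p%:R * (a ^+ 2 + b ^+ 2) / 2).
Proof.
move=> u1 a0 b0 c0 p3 podd ED [injA onD tanD].
have p1 : (1 < p)%N by exact: ltnW.
pose x := coord O u a \o A; pose y := coord O (perp u) b \o A.
set kappa := 2 * c ^+ 2 - 1.
have n1 k : x k ^+ 2 + y k ^+ 2 = 1 by have := onD k; rewrite ED.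
have one0 : 1 != 0 :> 'Z_p by exact: oner_neq0.
have two0 : 1 + 1 != 0 :> 'Z_p.
  by rewrite -val_eqE /= Zp_cast //= modn_small // modn_small.
have neq k h : h != 0 -> (x k, y k) <> (x (k + h), y (k + h)).
  move=> /eqP h0 [ex ey]; apply: h0.
  by apply: (addrI k); rewrite addr0; apply/esym/injA/(coord_inj u1 a0 b0 ex ey).
have hk k : x k * x (k + 1) + y k * y (k + 1) = kappa.
  apply: (tangent_chord c0 ED _ (onD k) (onD (k + 1)) (tanD k)) => EA.
  by apply: (neq k 1 one0); rewrite /x /y /= EA.
have rec k : x (k - 1) + x (k + 1) = 2 * kappa * x k
          /\ y (k - 1) + y (k + 1) = 2 * kappa * y k.
  apply: unit_circle_neighbors => //; first by have := hk (k - 1); rewrite subrK.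
  by have := neq (k - 1) (1 + 1) two0; rewrite addrA subrK.
have hx k := (rec k).1; have hy k := (rec k).2.
(* kappa = 1 would make consecutive vertices equal, and kappa = -1 means that
   c = 0. *)
have k1 : kappa ^+ 2 != 1.
  rewrite sqrf_eq1 negb_or; apply/andP; split; apply/eqP => ek.
    have := n1 0; have := n1 (0 + 1); have := hk 0; rewrite ek => e01 e1 e0.
    have : (x 0 - x (0 + 1)) ^+ 2 + (y 0 - y (0 + 1)) ^+ 2 == 0.
      by apply/eqP; nra.
    rewrite paddr_eq0 ?sqr_ge0 // !sqrf_eq0 !subr_eq0 => /andP[/eqP ex /eqP ey].
    by apply: (neq 0 1 one0); rewrite ex ey.
  have : c ^+ 2 == 0 by apply/eqP; move: ek; rewrite /kappa; lra.
  by rewrite sqrf_eq0 (negPf c0).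
under eq_bigr do rewrite (power_circle_radius _ u1 a0 b0 p1 podd hx hy).
rewrite -mulr_sumr -/x -/y; congr (_ * _).
have D0 : \sum_(k : 'Z_p) (x k ^+ 2 - y k ^+ 2) = 0.
  exact: sum_sqr_diff0 n1 hk hx hy k1.
transitivity (\sum_(k : 'Z_p) ((a ^+ 2 + b ^+ 2) / 2
    + (a ^+ 2 - b ^+ 2) / 2 * (x k ^+ 2 - y k ^+ 2))).
  apply: eq_bigr => k _.
  have -> : y k ^+ 2 = 1 - x k ^+ 2 by rewrite -(n1 k) addrC addKr.
  by field.
rewrite big_split /= sumr_const -mulr_sumr D0 mulr0 addr0 card_ord Zp_cast //.
by rewrite -[RHS]mulrA mulr_natl.
Qed.

Lemma sum_power_circle_area (R : realType) (p : nat) (A : 'Z_p -> R * R) :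
  (\sum_k area (power_circle A k)
   = (\sum_k Defs.radius (power_circle A k) ^+ 2)%:E
     * area (Circle (0 : R * R)%R 1%R))%E.
Proof.
rewrite -sumEFin ge0_sume_distrl; last by move=> k _; rewrite lee_fin sqr_ge0.
by apply: eq_bigr => k _; apply: area_scale; exact: sqrtr_ge0.
Qed.

Unset Implicit Arguments.

Theorem theorem2 (R : realType) (p : nat) (hp3 : (3 <= p)%N) (hodd : odd p)
    (O : R * R) (D1 D2 : set (R * R))
    (hD1 : ellipse O D1) (hD2 : ellipse O D2) (hhom : homothetic O D1 D2)
    (A A' : 'Z_p -> R * R)
    (hA : poncelet_family D1 D2 A) (hA' : poncelet_family D1 D2 A') :
  (\sum_(k : 'Z_p) area (power_circle A k)
   = \sum_(k : 'Z_p) area (power_circle A' k))%E.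
Proof.
case: hD1 => a [b [u [a0 b0 u1 ED]]]; case: hhom => c [c0 E2].
rewrite E2 in hA hA'; rewrite !sum_power_circle_area.
have an : a != 0 by rewrite gt_eqF.
have bn : b != 0 by rewrite gt_eqF.
rewrite (sum_power_circle_radius u1 an bn c0 hp3 hodd ED hA).
by rewrite (sum_power_circle_radius u1 an bn c0 hp3 hodd ED hA').
Qed.
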